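(* Let $G_B=(V_B,E_B)$ be a graph with $n=|V_B|$ even and $m=|E_B|$, let $h\geq 0$ be an integer, and let $G=(V,E)$ be the graph constructed from $G_B$ as described in the context. Then there exists a partition of $V_B$ into two sets $V_{B,1},V_{B,2}$ with $|V_{B,1}|=|V_{B,2}|$ such that at most $h$ edges of $G_B$ have one endpoint in $V_{B,1}$ and the other in $V_{B,2}$ if and only if there exists a feasible solution of 2-Overlapping Densest Subgraphs on $G$ with $\alpha=2/3$ of total density at least $\frac{2n^2-n+m-h}{\frac{3}{2}n}$.
   Context: Construction: $G$ consists of a clique $G_c=(V_c,E_c)$ on $n$ new vertices together with a copy of $G_B$, and every vertex of $V_B$ is joined by an edge to every vertex of $V_c$; so $V=V_c\cup V_B$, $|V|=2n$. A subgraph means an induced subgraph $G[U]$ for nonempty $U$; density of a graph with vertex set $V'$ and edge set $E'$ is $|E'|/|V'|$. A feasible solution of 2-Overlapping Densest Subgraphs with parameter $\alpha=2/3$ is a pair of subgraphs $G[V_1],G[V_2]$ with $V_1\neq V_2$, $|V_1\cap V_2|\leq \frac{2}{3}|V_1|$ and $|V_1\cap V_2|\leq\frac{2}{3}|V_2|$; its total density is $\mathrm{density}(G[V_1])+\mathrm{density}(G[V_2])$. *)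

(* Defs.v *)
From HB Require Import structures.
From mathcomp Require Import all_boot all_order all_algebra.
Set Implicit Arguments. Unset Strict Implicit. Unset Printing Implicit Defensive.
Import Order.TTheory GRing.Theory Num.Theory.
Local Open Scope ring_scope.

(* A simple graph on a finite vertex type V is a symmetric irreflexive
   relation r : rel V.  Edges are unordered pairs {x,y} with x != y, r x y. *)

Definition induced_edges (V : finType) (r : rel V) (U : {set V}) : {set {set V}} :=
  [set A : {set V} | (A \subset U) &&
     [exists x : V, exists y : V, [&& x != y, r x y & A == [set x; y]]]].

Definition all_edges (V : finType) (r : rel V) : {set {set V}} :=
  induced_edges r [set: V].

Definition cut_edges (V : finType) (r : rel V) (A : {set V}) : {set {set V}} :=
  [set S : {set V} | [exists x : V, exists y : V,
     [&& x \in A, y \notin A, r x y & S == [set x; y]]]].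

Definition density (V : finType) (r : rel V) (U : {set V}) : rat :=
  (#|induced_edges r U|)%:R / (#|U|)%:R.

Definition cons_vertex (T : finType) : finType := ('I_#|T| + T)%type.

Definition cons_rel (T : finType) (e : rel T) : rel (cons_vertex T) :=
  fun x y =>
    match x, y with
    | inl i, inl j => i != j
    | inl _, inr _ => true
    | inr _, inl _ => true
    | inr u, inr v => e u v
    end.

Definition feasible2 (V : finType) (alpha : rat) (V1 V2 : {set V}) : Prop :=
  [/\ V1 != set0, V2 != set0, V1 != V2,
      (#|V1 :&: V2|)%:R <= alpha * (#|V1|)%:R
    & (#|V1 :&: V2|)%:R <= alpha * (#|V2|)%:R].

(* Main.v *)
Require Import Defs.
From HB Require Import structures.
From mathcomp Require Import all_boot all_order all_algebra.
From mathcomp Require Import zify ring lra.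
Import Order.TTheory GRing.Theory Num.Theory.
Local Open Scope ring_scope.

(* Only pairs inside V_B can be non-adjacent, so with s = |U| and x the number
   of non-edges of G_B inside U the density of G[U] is (s - 1) / 2 - x / s.
   Put n = 2k.  A balanced partition (A, ~A) thus gives the total density
   3k - 1 - (x(A) + x(~A)) / (3k), and it suffices to find, for any feasible
   (V1, V2), such a partition of at least the same total density.
   Let i = |V1 & V2| and sj = |Vj|, so 3 i <= 2 sj.  Distributing the common
   vertices of V_B over the two sides yields disjoint Dj in Vj & V_B with
   sj <= n + |Dj| and s1 + s2 <= n + i + |D1| + |D2|.
   If both Dj have at most k vertices, enlarge them to a balanced partition:
   each added vertex creates at most k non-edges, which the slack
   (3n - s1 - s2) / 2 pays for.  If |D2| > k, then s2 <= 3 |D2|, and averaging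
   gives a k-subset of D2 keeping at most the fraction k / |D2| of the
   non-edges; its complement contains D1 and is paid for by the slack, since
   k - |D1| <= 3/2 (n - i). *)

(** The diagonal is harmless here, since [induced_edges] keeps only pairs with [x != y]. *)
Definition co_rel {V : Type} (r : rel V) : rel V := fun x y => ~~ r x y.

(** * Counting edges and non-edges; splitting vertex sets *)

Section Edges.
Context {V : finType}.
Implicit Types (r : rel V) (A B U : {set V}).
Local Open Scope nat_scope.

Lemma induced_edgesP r U (S : {set V}) :
  reflect (exists x y, [/\ x \in U, y \in U, x != y, r x y & S = [set x; y]])
          (S \in induced_edges r U).
Proof.
rewrite inE; apply: (iffP andP) => [[sSU /existsP[x /existsP[y /and3P[xy rxy /eqP ES]]]]|].
  exists x, y; split=> //; apply: (subsetP sSU); rewrite ES !inE eqxx ?orbT //.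
case=> x [y [xU yU xy rxy ->]]; split.
  by apply/subsetP => z; rewrite !inE => /orP[]/eqP->.
by apply/existsP; exists x; apply/existsP; exists y; rewrite xy rxy eqxx.
Qed.

Lemma set2_inj {x y a b : V} : [set x; y] = [set a; b] ->
  (x = a /\ y = b) \/ (x = b /\ y = a).
Proof.
move=> E.
have := set21 x y; rewrite E !inE => /orP[]/eqP xE.
  have := set22 x y; rewrite E !inE => /orP[]/eqP yE; last by left.
  by have := set22 a b; rewrite -E !inE => /orP[]/eqP bE; left; split; congruence.
have := set22 x y; rewrite E !inE => /orP[]/eqP yE; first by right.
by have := set21 a b; rewrite -E !inE => /orP[]/eqP aE; left; split; congruence.
Qed.

Lemma sym_pair_rel {r} {x y a b : V} : symmetric r ->
  [set x; y] = [set a; b] -> r x y = r a b.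
Proof. by move=> rs /set2_inj[] [-> ->]. Qed.

(** By symmetry the value of [r] depends only on the unordered pair, so no pair is counted on both
    sides. *)
Lemma card_induced_co r U : symmetric r ->
  #|induced_edges r U| + #|induced_edges (co_rel r) U| = 'C(#|U|, 2).
Proof.
move=> rs; rewrite -cards_draws -cardsUI.
rewrite [_ :&: _](_ : _ = set0) ?cards0 ?addn0.
  congr #|pred_of_set _|; apply/setP => S; rewrite !inE; apply/orP/andP.
    have sz x y : x != y -> #|[set x; y]| == 2 by move=> xy; rewrite cards2 xy.
    by case=> /andP[-> /existsP[x /existsP[y /and3P[xy _ /eqP->]]]]; rewrite sz.
  case=> -> /cards2P[x [y [xy ->]]] /=.
  have [rxy|rxy] := boolP (r x y); [left|right]; rewrite /=;
  by apply/existsP; exists x; apply/existsP; exists y; rewrite xy /co_rel rxy eqxx.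
apply/setP => S; rewrite in_set0; apply/negP; rewrite in_setI => /andP[].
move=> /induced_edgesP[x [y [_ _ _ rxy ->]]] /induced_edgesP[a [b [_ _ _ rab E]]].
by move: rab; rewrite /co_rel -(sym_pair_rel rs E) rxy.
Qed.

Lemma induced_edgesS r A B : A \subset B ->
  #|induced_edges r A| <= #|induced_edges r B|.
Proof.
move=> sAB; apply/subset_leq_card/subsetP => S; rewrite !inE => /andP[sSA ->].
by rewrite (subset_trans sSA sAB).
Qed.

(** An edge not inside [B] has an endpoint in [A :\: B] and the other in [A]. *)
Lemma card_induced_extend r A B : B \subset A ->
  #|induced_edges r A| <= #|induced_edges r B| + (#|A| - #|B|) * #|A|.
Proof.
move=> sBA.
pose P := [set [set p.1; p.2] | p in setX (A :\: B) A].
apply: (@leq_trans #|induced_edges r B :|: P|).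
  apply/subset_leq_card/subsetP => S /induced_edgesP[x [y [xA yA xy rxy ->]]].
  rewrite in_setU; have [xB|xB] := boolP (x \in B); last first.
    apply/orP; right; apply/imsetP; exists (x, y) => //.
    by rewrite !inE xB xA yA.
  have [yB|yB] := boolP (y \in B); last first.
    apply/orP; right; apply/imsetP; exists (y, x); rewrite 1?setUC //.
    by rewrite !inE yB xA yA.
  by apply/orP; left; apply/induced_edgesP; exists x, y.
rewrite (leq_trans (leq_card_setU _ _)) // leq_add2l.
by rewrite (leq_trans (leq_imset_card _ _)) // cardsX cardsDS.
Qed.


(* Averaging over the [x] in [B]: deleting an endpoint destroys an edge, so each
   edge survives in at most [#|B| - 1] of the sets [B :\ x]. *)
Lemma exists_sparse_subset r B k : k <= #|B| ->
  exists2 A : {set V}, A \subset B /\ #|A| = k &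
    #|induced_edges r A| * #|B| <= #|induced_edges r B| * k.
Proof.
elim: {B}_.+1 {-2}B (ltnSn #|B|) => // b IHb B; rewrite ltnS => leB.
rewrite leq_eqVlt => /orP[/eqP->|ltkB]; first by exists B.
have [x xB lex] : exists2 x, x \in B &
    #|induced_edges r (B :\ x)| * #|B| <= #|induced_edges r B| * #|B|.-1.
  apply/exists_inP; apply: contraT; rewrite negb_exists_in => /forall_inP H.
  have B0 : 0 < #|B| by lia.
  have : \sum_(x in B) (#|induced_edges r B| * #|B|.-1) <
         \sum_(x in B) #|induced_edges r (B :\ x)| * #|B|.
    have /card_gt0P[x0 x0B] := B0.
    rewrite !(bigD1 x0 x0B) /= -addSn leq_add //; first by rewrite ltnNge H.
    by apply: leq_sum => x /andP[xB _]; rewrite ltnW // ltnNge H.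
  rewrite ltnNge => /negP; case.
  rewrite sum_nat_const -big_distrl /= [X in _ <= X]mulnC leq_mul2r.
  apply/orP; right.
  rewrite (eq_bigr (fun x => \sum_(S in induced_edges r B) (x \notin S))); last first.
    move=> x xB; rewrite -sum1dep_card big_mkcond [RHS]big_mkcond /=.
    apply: eq_bigr => S _; rewrite !inE subsetD1.
    by case: (S \subset B); case: (x \notin S); case: [exists _, _].
  rewrite exchange_big -sum_nat_const.
  apply: leq_sum => S /induced_edgesP[y [z [yB _ _ _ ES]]].
  rewrite (bigD1 y yB) ES set21 /= add0n (cardsD1 y B) yB add1n /=.
  rewrite -sum1_card [X in _ <= X](eq_bigl (fun x => (x \in B) && (x != y))).
    by apply: leq_sum => w _; case: (_ \notin _).
  by move=> w; rewrite !inE andbC.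
have cB : #|B| = #|B :\ x|.+1 by rewrite (cardsD1 x B) xB.
have [||A [sA cA] leA] := IHb (B :\ x); try lia.
exists A; first by split=> //; exact: subset_trans sA (subsetDl _ _).
(* The factor [#|B :\ x|] is cancelled below; if it is zero, then [k = 0] and [A] is empty. *)
have [c0|c0] := posnP #|B :\ x|.
  have A0 : A = set0 by apply/eqP; rewrite -cards_eq0 cA; lia.
  rewrite (_ : induced_edges r A = set0) ?cards0 //.
  apply/setP => S; rewrite in_set0; apply/negP => /induced_edgesP[y [z [yA _ _ _ _]]].
  by rewrite A0 in_set0 in yA.
rewrite -(leq_pmul2r c0) mulnAC.
apply: (@leq_trans (#|induced_edges r (B :\ x)| * k * #|B|)).
  by rewrite leq_mul2r leA orbT.
rewrite mulnAC [X in _ <= X]mulnAC leq_mul2r (_ : #|B :\ x| = #|B|.-1).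
  by rewrite lex orbT.
by rewrite cB.
Qed.

Lemma card_all_edges r A : symmetric r ->
  #|all_edges r| =
    #|induced_edges r A| + #|induced_edges r (~: A)| + #|cut_edges r A|.
Proof.
move=> rs.
have cutP S : reflect (exists x y, [/\ x \in A, y \notin A, r x y & S = [set x; y]])
    (S \in cut_edges r A).
  rewrite inE; apply: (iffP existsP) => [[x /existsP[y /and4P[xA yA rxy /eqP ->]]]|].
    by exists x, y.
  case=> x [y [xA yA rxy ->]]; exists x; apply/existsP; exists y.
  by rewrite xA yA rxy eqxx.
have ind S : (S \in induced_edges r A) = (S \in all_edges r) && (S \subset A).
  by rewrite !inE subsetT /= andbC.
have indC S : (S \in induced_edges r (~: A)) = (S \in all_edges r) && (S \subset ~: A).
  by rewrite !inE subsetT /= andbC.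
have s2 (x y : V) (B : {set V}) : ([set x; y] \subset B) = (x \in B) && (y \in B).
  by rewrite subUset !sub1set.
rewrite -(cardsID (induced_edges r A)) -addnA; congr (_ + _).
  by apply: eq_card => S; rewrite inE ind; case: (S \in all_edges r).
rewrite -(cardsID (induced_edges r (~: A))); congr (_ + _).
  apply: eq_card => S; rewrite !in_setI !in_setD ind indC.
  have [/induced_edgesP[x [y [_ _ _ _ ->]]]|] := boolP (S \in all_edges r); last by rewrite !andbF.
  by rewrite !s2 !inE; case: (x \in A); case: (y \in A).
apply: eq_card => S; rewrite !in_setD ind indC.
apply/idP/cutP => [|[x [y [xA yA rxy ->]]]]; last first.
  rewrite !s2 !inE xA (negPf yA) !andbF /= ?andbT.
  apply/andP; split; first exact: subsetT.
  apply/existsP; exists x; apply/existsP; exists y; rewrite rxy eqxx !andbT.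
  by apply: contraNneq yA => <-.
have [/induced_edgesP[x [y [_ _ xy rxy ->]]]|] := boolP (S \in all_edges r); last by rewrite !andbF.
rewrite !s2 !inE.
have [xA|xA] := boolP (x \in A); have [yA|yA] := boolP (y \in A) => //= _.
  by exists x, y.
by exists y, x; rewrite rs setUC.
Qed.

Lemma subset_between (B D : {set V}) k : B \subset D -> #|B| <= k -> k <= #|D| ->
  exists A : {set V}, [/\ B \subset A, A \subset D & #|A| = k].
Proof.
move=> sBD lBk lkD; pose E := D :\: B.
have cE : #|E| = #|D| - #|B| by rewrite cardsDS.
have : 0 < #|[set A : {set V} | A \subset E & #|A| == k - #|B|]|.
  by rewrite cards_draws bin_gt0 cE; lia.
case/card_gt0P => A; rewrite inE => /andP[sAE /eqP cA].
exists (B :|: A); split; first exact: subsetUl.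
  by rewrite subUset sBD (subset_trans sAE) ?subsetDl.
rewrite cardsU (_ : B :&: A = set0) ?cards0; first by lia.
apply/eqP; rewrite setI_eq0 disjoint_sym; apply/(disjointWl sAE).
by rewrite -setI_eq0 /E setDE -setIA [~: B :&: B]setIC setICr setI0.
Qed.

(** Each common vertex is dropped from exactly one side: up to [a1] of them, the set [K], from [B1]
    and the rest from [B2]. *)
Lemma disjoint_refinement (B1 B2 : {set V}) a1 a2 : #|B1 :&: B2| <= a1 + a2 ->
  exists D1 D2 : {set V}, [/\ D1 \subset B1, D2 \subset B2, [disjoint D1 & D2]
    & [/\ #|B1| <= #|D1| + a1, #|B2| <= #|D2| + a2
        & #|D1| + #|D2| + #|B1 :&: B2| = #|B1| + #|B2|]].
Proof.
move=> le_a; pose k1 := minn a1 #|B1 :&: B2|.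
have [||K [_ sK cK]] := @subset_between set0 (B1 :&: B2) k1 (sub0set _).
- by rewrite cards0.
- exact: geq_minr.
exists (B1 :\: K), (B2 :\: ((B1 :&: B2) :\: K)); split; rewrite ?subsetDl //.
  rewrite -setI_eq0; apply/eqP/setP => x; rewrite !inE.
  by case: (x \in K); case: (x \in B1); case: (x \in B2).
rewrite !cardsDS ?(subset_trans sK) ?subsetIl // ?(subset_trans (subsetDl _ _)) ?subsetIr //.
have := subset_leq_card (subsetIl B1 B2); have := subset_leq_card (subsetIr B1 B2).
by rewrite cK /k1 => *; split; lia.
Qed.
End Edges.

(** * Comparing non-edge shares with those at the final size 3k *)

Lemma share_extend (k s x y t : nat) : (0 < s)%N -> (s <= 3 * k)%N ->
  (y <= x + t * k)%N ->
  y%:R / (3 * k%:R) <= x%:R / s%:R + t%:R / 3 :> rat.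
Proof.
move=> s0 sk yx; have k0 : (0 < k)%N by lia.
have kR : 0 < k%:R :> rat by rewrite ltr0n.
apply: (@le_trans _ _ ((x%:R + t%:R * k%:R) / (3 * k%:R))).
  by rewrite ler_pM2r ?invr_gt0 ?mulr_gt0 // -natrM -natrD ler_nat.
(* Each of the [t] added vertices costs [k] non-edges, hence 1/3 after division by 3k. *)
rewrite mulrDl (_ : t%:R * k%:R / _ = t%:R / 3); last by field; lra.
rewrite lerD2r ler_wpM2l ?ler0n // lef_pV2 ?posrE ?ltr0n ?mulr_gt0 //.
by rewrite -natrM ler_nat.
Qed.

(** The chain is y/(3k) <= x/(3b) <= x/s. *)
Lemma share_sparse (k s b x y : nat) : (0 < s)%N -> (0 < k)%N -> (0 < b)%N ->
  (s <= 3 * b)%N -> (y * b <= x * k)%N ->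
  y%:R / (3 * k%:R) <= x%:R / s%:R :> rat.
Proof.
move=> s0 k0 b0 sb yx.
rewrite ler_pdivrMr ?mulr_gt0 ?ltr0n // mulrAC ler_pdivlMr ?ltr0n //.
rewrite -!natrM ler_nat -(leq_pmul2r b0); nia.
Qed.

(** * Balanced partitions with few non-edges *)

Section Bisection.
Context {V : finType} (r : rel V) (k : nat).
Hypothesis (k_pos : (0 < k)%N) (cardV : #|V| = (2 * k)%N).
Local Notation x B := #|induced_edges r B|.

(** The slack (6k - s1 - s2)/2 is what the terms (s - 1)/2 of the two densities gain when both sizes
    become 3k. *)
Lemma sparse_bisection_small (B1 B2 : {set V}) (s1 s2 i : nat) :
  [disjoint B1 & B2] -> (#|B1| <= k)%N -> (0 < s1)%N -> (0 < s2)%N ->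
  (3 * i <= 2 * s1)%N -> (3 * i <= 2 * s2)%N ->
  (s1 <= 2 * k + #|B1|)%N -> (s2 <= 2 * k + #|B2|)%N ->
  (s1 + s2 <= 2 * k + i + #|B1| + #|B2|)%N ->
  exists2 A : {set V}, #|A| = k &
    (x A + x (~: A))%:R / (3 * k%:R) <=
    (6 * k%:R - s1%:R - s2%:R) / 2 + (x B1)%:R / s1%:R + (x B2)%:R / s2%:R :> rat.
Proof.
move=> dB b1k s1_gt0 s2_gt0 is1 is2 sb1 sb2 sbi.
have cC (B : {set V}) : (#|B| + #|~: B| = 2 * k)%N by rewrite cardsC.
have [b2k|kb2] := leqP #|B2| k.
  have [|||A [B1A AB2 cA]] := @subset_between _ B1 (~: B2) k.
  - by rewrite -disjoints_subset.
  - by [].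
  - by have := cC B2; lia.
  exists A => //; have cA' : #|~: A| = k by have := cC A; lia.
  have B2A : B2 \subset ~: A by rewrite -setCS setCK.
  have := card_induced_extend r _ _ B1A; have := card_induced_extend r _ _ B2A.
  rewrite cA cA' => /(share_extend _ _ _ _ _ s2_gt0) x2 /(share_extend _ _ _ _ _ s1_gt0) x1.
  have {}x1 := x1 ltac:(lia); have {}x2 := x2 ltac:(lia).
  (* The left side is at most 4k + i, and i <= 2k because 3i <= 2 s1 <= 6k. *)
  have : ((k - #|B1|)%:R + (k - #|B2|)%:R + s1%:R + s2%:R <= 6 * k%:R :> rat).
    by rewrite -!natrD -natrM ler_nat; lia.
  have : 0 <= (k - #|B1|)%:R + (k - #|B2|)%:R :> rat by rewrite -natrD ler0n.
  move=> t_ge0 le_t; rewrite (natrD _ (x A)) mulrDl; apply: le_trans (lerD x1 x2) _.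
  lra.
have [|D [DB2 cD] xD] := exists_sparse_subset r B2 k; first by lia.
exists (~: D); first by have := cC D; lia.
have B1D : B1 \subset ~: D.
  by apply: subset_trans (_ : ~: B2 \subset _); rewrite ?setCS // -disjoints_subset.
have := card_induced_extend r _ _ B1D.
rewrite (_ : #|~: D| = k); last by have := cC D; lia.
move=> /(share_extend _ _ _ _ _ s1_gt0) x1; have {}x1 := x1 ltac:(lia).
have x2 : (x D)%:R / (3 * k%:R) <= (x B2)%:R / s2%:R :> rat.
  by apply: share_sparse xD => //; lia.
(* Disjointness gives s1 + s2 <= 4k + i, and 3i <= 2 s1 <= 4k + 2 [#|B1|]. *)
have : (2 * (k - #|B1|)%:R + 3 * (s1%:R + s2%:R) <= 18 * k%:R :> rat).
  have := subset_leq_card (_ : B1 \subset ~: B2); rewrite -disjoints_subset => /(_ dB).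
  by have := cC B2; rewrite -natrD -!natrM -natrD ler_nat; lia.
move=> le_t; rewrite setCK (natrD _ _ (x D)) mulrDl; apply: le_trans (lerD x1 x2) _.
lra.
Qed.

Lemma sparse_bisection (B1 B2 : {set V}) (s1 s2 i : nat) :
  [disjoint B1 & B2] -> (0 < s1)%N -> (0 < s2)%N ->
  (3 * i <= 2 * s1)%N -> (3 * i <= 2 * s2)%N ->
  (s1 <= 2 * k + #|B1|)%N -> (s2 <= 2 * k + #|B2|)%N ->
  (s1 + s2 <= 2 * k + i + #|B1| + #|B2|)%N ->
  exists2 A : {set V}, #|A| = k &
    (x A + x (~: A))%:R / (3 * k%:R) <=
    (6 * k%:R - s1%:R - s2%:R) / 2 + (x B1)%:R / s1%:R + (x B2)%:R / s2%:R :> rat.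
Proof.
move=> dB s1_gt0 s2_gt0 is1 is2 sb1 sb2 sbi.
have [b1k|kb1] := leqP #|B1| k; first exact: (sparse_bisection_small _ _ _ _ i).
(* Two disjoint sets among 2k vertices cannot both exceed [k], so exchanging the indices
   suffices. *)
have b2k : (#|B2| <= k)%N.
  have := max_card (B1 :|: B2).
  by rewrite cardsU cardV; move: dB; rewrite -setI_eq0 => /eqP->; rewrite cards0; lia.
have [||A cA le] := sparse_bisection_small B2 B1 s2 s1 i _ b2k s2_gt0 s1_gt0 is2 is1 sb2 sb1.
- by rewrite disjoint_sym.
- lia.
by exists A => //; apply: le_trans le _; lra.
Qed.
End Bisection.

(** * Densities and non-edges in the constructed graph *)

Lemma densityE (V : finType) (r : rel V) (U : {set V}) :
  symmetric r -> (0 < #|U|)%N ->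
  density r U =
    (#|U|%:R - 1) / 2 - #|induced_edges (co_rel r) U|%:R / #|U|%:R.
Proof.
move=> rs U0; have := card_induced_co r U rs.
move/(congr1 (muln ^~ 2)); rewrite /density.
have -> : ('C(#|U|, 2) * 2 = #|U| * #|U|.-1)%N.
  by apply: etrans (bin_ffact #|U| 2) _; rewrite ffactnSr ffactn1 subn1.
move/(congr1 (fun z : nat => z%:R : rat)).
rewrite !natrM natrD -subn1 natrB // => E.
have U0' : #|U|%:R != 0 :> rat by rewrite pnatr_eq0 -lt0n.
apply: (mulIf U0'); rewrite mulrBl !divfK //; lra.
Qed.

Section Construction.
Context {T : finType} (e : rel T).
Hypothesis e_sym : symmetric e.

Lemma cons_rel_sym : symmetric (cons_rel e).
Proof. by move=> [i|u] [j|v] //=; rewrite eq_sym. Qed.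

Lemma card_cons_set (U : {set cons_vertex T}) :
  #|U| = (#|[set i : 'I_#|T| | inl i \in U]| + #|[set v : T | inr v \in U]|)%N.
Proof.
rewrite -(card_imset [set i : 'I_#|T| | inl i \in U] (@inl_inj _ T)).
rewrite -(card_imset [set v : T | inr v \in U] (@inr_inj 'I_#|T| _)).
rewrite -cardsUI [X in (_ + #|pred_of_set X|)%N](_ : _ = set0) ?cards0 ?addn0.
  apply: eq_card => -[i|v]; rewrite in_setU.
    rewrite mem_imset ?inE; last exact: inl_inj.
    by rewrite orb_idr // => /imsetP[].
  rewrite orbC mem_imset ?inE; last exact: inr_inj.
  by rewrite orb_idr // => /imsetP[].
by apply/setP => z; rewrite !inE; apply/negP => /andP[/imsetP[i _ ->] /imsetP[]].
Qed.

Lemma card_induced_co_cons (U : {set cons_vertex T}) :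
  #|induced_edges (co_rel (cons_rel e)) U| =
  #|induced_edges (co_rel e) [set v : T | inr v \in U]|.
Proof.
have inr_inj' := @inr_inj 'I_#|T| T.
rewrite -(card_imset _ (imset_inj inr_inj')); apply: eq_card => S.
apply/induced_edgesP/imsetP.
  case=> -[i|u] [[j|v] [xU yU xy rxy ->]] //.
    by move: rxy; rewrite /co_rel /= negbK => /eqP ij; rewrite ij eqxx in xy.
  exists [set u; v]; last by rewrite imsetU !imset_set1.
  by apply/induced_edgesP; exists u, v; rewrite !inE.
case=> R /induced_edgesP[u [v [uU vU uv ruv ->]]] ->.
rewrite !inE in uU vU; exists (inr u), (inr v); split=> //.
by rewrite imsetU !imset_set1.
Qed.
End Construction.

(** * From bisections to feasible pairs and back *)

Section Correspondence.
Context {T : finType} (e : rel T) (k : nat).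
Hypotheses (e_sym : symmetric e) (k_pos : (0 < k)%N) (cardT : #|T| = (2 * k)%N).
Local Notation x A := #|induced_edges (co_rel e) A|.

(** The two halves contain k(k - 1) pairs altogether, so edges minus cut edges equal k(k - 1) minus
    the non-edges inside the halves. *)
Lemma bisection_threshold (A : {set T}) : #|A| = k ->
  (2 * (#|T| ^ 2)%N%:R - #|T|%:R + #|all_edges e|%:R - #|cut_edges e A|%:R)
    / (3 / 2 * #|T|%:R)
  = 3 * k%:R - 1 - (x A + x (~: A))%:R / (3 * k%:R) :> rat.
Proof.
move=> cA; have cA' : #|~: A| = k by have := cardsC A; lia.
have kR : k%:R != 0 :> rat by rewrite pnatr_eq0 -lt0n.
have bin2k : ('C(k, 2) * 2 + k = k * k)%N.
  have E : ('C(k, 2) * 2 = k * k.-1)%N.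
    by apply: etrans (bin_ffact k 2) _; rewrite ffactnSr ffactn1 subn1.
  by rewrite E -mulnSr prednK.
have : (#|all_edges e| + (x A + x (~: A)) + k = #|cut_edges e A| + k * k)%N.
  have := card_induced_co e A e_sym; have := card_induced_co e (~: A) e_sym.
  by rewrite (card_all_edges e A e_sym) cA cA' -bin2k; lia.
move/(congr1 (fun z : nat => z%:R : rat)); rewrite [LHS]natrD natrD [RHS]natrD natrM.
move=> E; rewrite cardT natrX natrM.
have -> : #|all_edges e|%:R = #|cut_edges e A|%:R + k%:R * k%:R
    - (x A + x (~: A))%:R - k%:R :> rat by lra.
by field.
Qed.

Lemma bisection_densities (A : {set T}) : #|A| = k ->
  exists V1 V2 : {set cons_vertex T}, feasible2 (2 / 3) V1 V2 /\
    density (cons_rel e) V1 + density (cons_rel e) V2 =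
    3 * k%:R - 1 - (x A + x (~: A))%:R / (3 * k%:R).
Proof.
move=> cA; have cA' : #|~: A| = k by have := cardsC A; lia.
(* The whole clique together with [B]: for the two halves the overlap is the clique, of size 2k, so
   the bound 2/3 of 3k is met with equality. *)
pose W (B : {set T}) : {set cons_vertex T} :=
  [set z | if z is inr v then v \in B else true].
have inrW B : [set v : T | inr v \in W B] = B by apply/setP => v; rewrite !inE.
have inlW B : [set i : 'I_#|T| | inl i \in W B] = setT by apply/setP => v; rewrite !inE.
have cW B : #|W B| = (2 * k + #|B|)%N.
  by rewrite card_cons_set inrW inlW cardsT card_ord cardT.
have WI : W A :&: W (~: A) = W set0.
  by apply/setP => -[i|v]; rewrite !inE //= andbN.
have c1 : #|W A| = (3 * k)%N by rewrite cW cA; lia.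
have c2 : #|W (~: A)| = (3 * k)%N by rewrite cW cA'; lia.
exists (W A), (W (~: A)); split.
  have [v vA] : exists v, v \in A by apply/card_gt0P; rewrite cA.
  split; rewrite -?card_gt0 ?c1 ?c2; try lia.
  - by apply/eqP => /setP/(_ (inr v)); rewrite !inE vA.
  - by rewrite WI cW cards0 addn0 !natrM; lra.
  - by rewrite WI cW cards0 addn0 !natrM; lra.
have cs := cons_rel_sym e e_sym.
rewrite !densityE ?c1 ?c2 //; try lia.
rewrite !card_induced_co_cons !inrW natrD natrM.
have kR : k%:R != 0 :> rat by rewrite pnatr_eq0 -lt0n.
by field.
Qed.

Lemma feasible_densities_le (V1 V2 : {set cons_vertex T}) :
  feasible2 (2 / 3) V1 V2 ->
  exists2 A : {set T}, #|A| = k &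
    density (cons_rel e) V1 + density (cons_rel e) V2 <=
    3 * k%:R - 1 - (x A + x (~: A))%:R / (3 * k%:R).
Proof.
case; rewrite -!card_gt0 => s1_gt0 s2_gt0 _ i1 i2.
have {}i1 : (3 * #|V1 :&: V2| <= 2 * #|V1|)%N.
  by rewrite -(ler_nat rat) !natrM; lra.
have {}i2 : (3 * #|V1 :&: V2| <= 2 * #|V2|)%N.
  by rewrite -(ler_nat rat) !natrM; lra.
have cs := cons_rel_sym e e_sym.
rewrite !densityE // !card_induced_co_cons.
have c1 := card_cons_set V1; have c2 := card_cons_set V2.
have cI := card_cons_set (V1 :&: V2).
set C1 := [set i : 'I_#|T| | inl i \in V1] in c1.
set C2 := [set i : 'I_#|T| | inl i \in V2] in c2.
set B1 := [set v : T | inr v \in V1] in c1 *.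
set B2 := [set v : T | inr v \in V2] in c2 *.
rewrite (_ : [set i : 'I_#|T| | _] = C1 :&: C2) in cI; last by apply/setP => ?; rewrite !inE.
rewrite (_ : [set v : T | _] = B1 :&: B2) in cI; last by apply/setP => ?; rewrite !inE.
have uC := cardsUI C1 C2; have uB := cardsUI B1 B2.
have := max_card (C1 :|: C2); have := max_card (B1 :|: B2).
have := max_card C1; have := max_card C2.
rewrite card_ord => mC2 mC1 mB mC.
(* The capacities count the clique vertices missing from each [Vj]. They suffice: the overlap bounds
   add up to 3 [#|V1 :&: V2|] <= [#|V1|] + [#|V2|], while [#|C1 :&: C2|] >= [#|C1|] + [#|C2|] - 2k
   and [#|B1|] + [#|B2|] <= 2k + [#|B1 :&: B2|]. *)
have [|D1 [D2 [sD1 sD2 dD [d1 d2 d12]]]] :=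
  disjoint_refinement B1 B2 (2 * k - #|C1|) (2 * k - #|C2|); first by lia.
have [|||A cA le] := sparse_bisection (co_rel e) k k_pos cardT D1 D2
  #|V1| #|V2| #|V1 :&: V2| dD s1_gt0 s2_gt0 i1 i2; try lia.
exists A => //.
(* Shrinking [Bj] to [Dj] with the denominator kept only lowers the share of non-edges. *)
have le1 : (x D1)%:R / #|V1|%:R <= (x B1)%:R / #|V1|%:R :> rat.
  by rewrite ler_pM2r ?invr_gt0 ?ltr0n // ler_nat induced_edgesS.
have le2 : (x D2)%:R / #|V2|%:R <= (x B2)%:R / #|V2|%:R :> rat.
  by rewrite ler_pM2r ?invr_gt0 ?ltr0n // ler_nat induced_edgesS.
lra.
Qed.
End Correspondence.

Theorem theorem21 (T : finType) (e : rel T)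
  (e_sym : symmetric e) (e_irr : irreflexive e)
  (n_pos : (0 < #|T|)%N) (n_even : ~~ odd #|T|) (h : nat) :
  let n := #|T| in
  let m := #|all_edges e| in
  (exists A : {set T}, #|A| = #|~: A| /\ (#|cut_edges e A| <= h)%N)
  <->
  (exists V1 V2 : {set cons_vertex T},
     feasible2 (2 / 3) V1 V2 /\
     ((2 * (n ^ 2)%N%:R - n%:R + m%:R - h%:R) / (3 / 2 * n%:R) : rat)
       <= density (cons_rel e) V1 + density (cons_rel e) V2).
Proof.
move=> n m; pose k := (#|T|)./2.
have cardT : #|T| = (2 * k)%N by rewrite /k; lia.
have k_pos : (0 < k)%N by lia.
(* The threshold strictly decreases in [h], so cut sizes can be compared through thresholds. *)
have cut_le (A : {set T}) :
  ((2 * (n ^ 2)%N%:R - n%:R + m%:R - h%:R) / (3 / 2 * n%:R) <=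
   (2 * (n ^ 2)%N%:R - n%:R + m%:R - #|cut_edges e A|%:R) / (3 / 2 * n%:R) :> rat)
  = (#|cut_edges e A| <= h)%N.
  by rewrite ler_pM2r ?invr_gt0 ?mulr_gt0 ?ltr0n // lerD2l lerN2 ler_nat.
split=> [[A [cA cut_h]] | [V1 [V2 [feas dens]]]].
  have {}cA : #|A| = k by have := cardsC A; lia.
  have [V1 [V2 [feas dens]]] := bisection_densities e k e_sym k_pos cardT A cA.
  exists V1, V2; split=> //; rewrite dens.
  by rewrite -(bisection_threshold e k e_sym k_pos cardT A cA) cut_le.
have [A cA le] := feasible_densities_le e k e_sym k_pos cardT V1 V2 feas.
exists A; split; first by have := cardsC A; lia.
rewrite -cut_le (bisection_threshold e k e_sym k_pos cardT A cA).
exact: le_trans dens le.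
Qed.
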